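(* For (8-4)-frames $F=\langle W,R,I\rangle$, the condition ''$F$ is Euclidean'' is not equivalent to the condition ''$F\vDash\Diamond\varphi\to\Box\Diamond\varphi$ (for every formula $\varphi$)''; that is, it is not the case that for every (8-4)-frame $F$ the two conditions are equivalent.
   Context: A frame is Euclidean when $wRu$ and $wRu'$ imply $uRu'$ for all $w,u,u'$. Formulas (language $\mathcal{L}^{\Box,\circ}$) are built from a denumerable set $\mathrm{Var}$ of variables with unary $\neg,\Box,\circ$ and binary $\wedge,\vee$; $\alpha\to\beta:=\neg\alpha\vee\beta$, $\Diamond\alpha:=\neg\Box\neg\alpha$. (8-4)-semantics: let $B_8$ be the eight-element Boolean algebra (top $1$, bottom $0$, join $+$, meet $\cdot$, complement $-$), with $\circledcirc x=1$ if $x\in\{0,1\}$ and $\circledcirc x=0$ otherwise, and $U$ any fixed ultrafilter of $B_8$. Let $B_1,B_2,B_3$ be the three four-element Boolean subalgebras of $B_8$. An (8-4)-frame is $F=\langle W,R,I\rangle$ with $W\neq\emptyset$, $R\subseteq W\times W$, $I:W\to\{B_1,B_2,B_3\}$; write $L_w=I(w)$. A model $M$ based on $F$ adds a function $v$ with $v_w(p)=v(w,p)\in L_w$ for $w\in W$, $p\in\mathrm{Var}$. For $x\in B_8$ and $L'\in\{B_1,B_2,B_3\}$, $x^{L'}=\bigvee_{L'}\{y\in L'\mid y\leq x\}$. Each $v_w$ extends to formulas by $v_w(\neg\alpha)=-v_w(\alpha)$, $v_w(\alpha\vee\beta)=v_w(\alpha)+v_w(\beta)$, $v_w(\alpha\wedge\beta)=v_w(\alpha)\cdot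 v_w(\beta)$, $v_w(\circ\alpha)=\circledcirc(v_w(\alpha))$, $v_w(\Box\alpha)=\bigwedge_{L_w}\{(v_u(\alpha))^{L_w}\mid u\in W,\ wRu\}$. $M,w\vDash\varphi$ iff $v_w(\varphi)\in U\cap L_w$; $M\vDash\varphi$ iff $M,w\vDash\varphi$ for all $w\in W$; $F\vDash\varphi$ iff $M\vDash\varphi$ for every model $M$ based on $F$. *)

(* Defs.v *)
From mathcomp Require Import all_boot.
From mathcomp Require Import boolp.

Set Implicit Arguments.
Unset Strict Implicit.
Unset Printing Implicit Defensive.

(* The eight-element Boolean algebra, as the powerset of a three-element set:
   0, 1, +, . and - are set0, setT, :|:, :&: and ~:, and <= is \subset. *)
Definition B8 := {set 'I_3}.

Definition circled (x : B8) : B8 :=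
  if (x == set0) || (x == setT) then setT else set0.

Definition subalgebra (L : {set B8}) : bool :=
  [&& set0 \in L, setT \in L,
      [forall x in L, ~: x \in L],
      [forall x in L, forall y in L, x :|: y \in L] &
      [forall x in L, forall y in L, x :&: y \in L]].

(* There are exactly three of these, {0, a, -a, 1} for the three atoms a. *)
Definition subalgebra4 (L : {set B8}) : bool := subalgebra L && (#|L| == 4).

Definition proper_filter (U : {set B8}) : bool :=
  [&& setT \in U, set0 \notin U,
      [forall x in U, forall y in U, x :&: y \in U] &
      [forall x in U, forall y : B8, (x \subset y) ==> (y \in U)]].

Definition ultrafilter (U : {set B8}) : bool := maxset proper_filter U.

(* Join and meet in a subalgebra L of the family of those elements of L that
   satisfy P.  As L is a finite subalgebra they are computed as in B8; the empty
   join is 0 and the empty meet is 1.  The set of worlds may be infinite, hence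
   the classical `[< _ >]. *)
Definition joinL (L : {set B8}) (P : B8 -> Prop) : B8 :=
  \bigcup_(y in L | `[< P y >]) y.
Definition meetL (L : {set B8}) (P : B8 -> Prop) : B8 :=
  \bigcap_(y in L | `[< P y >]) y.

(* x^L *)
Definition approx (L : {set B8}) (x : B8) : B8 := joinL L (fun y => y \subset x).

Definition Var := nat.

Inductive formula : Type :=
| FVar of Var
| FNeg of formula
| FBox of formula
| FCirc of formula
| FAnd of formula & formula
| FOr of formula & formula.

Definition FImp (a b : formula) : formula := FOr (FNeg a) b.
Definition FDia (a : formula) : formula := FNeg (FBox (FNeg a)).

Record frame84 : Type := Frame84 {
  world : Type;
  world_inhabited : inhabited world;
  acc : world -> world -> Prop;
  alg : world -> {set B8};
  alg_subalgebra4 : forall w, subalgebra4 (alg w) }.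

Record model84 (F : frame84) : Type := Model84 {
  val84 : world F -> Var -> B8;
  val84_in : forall w p, val84 w p \in alg w }.

Definition euclidean (F : frame84) : Prop :=
  forall w u u' : world F, acc w u -> acc w u' -> acc u u'.

Fixpoint eval (F : frame84) (M : model84 F) (phi : formula) (w : world F) : B8 :=
  match phi with
  | FVar p => val84 M w p
  | FNeg a => ~: eval M a w
  | FBox a => meetL (alg w)
      (fun y => exists u, acc w u /\ y = approx (alg w) (eval M a u))
  | FCirc a => circled (eval M a w)
  | FAnd a b => eval M a w :&: eval M b w
  | FOr a b => eval M a w :|: eval M b w
  end.

Definition sat (U : {set B8}) (F : frame84) (M : model84 F) (w : world F)
    (phi : formula) : Prop := eval M phi w \in U :&: alg w.

Definition model_valid (U : {set B8}) (F : frame84) (M : model84 F)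
    (phi : formula) : Prop := forall w, sat U M w phi.

Definition frame_valid (U : {set B8}) (F : frame84) (phi : formula) : Prop :=
  forall M : model84 F, model_valid U M phi.

Lemma joinL_in L P : subalgebra L -> joinL L P \in L.
Proof.
case/and5P=> L0 _ _ /forall_inP LU _; rewrite /joinL.
elim/big_ind: _ => // [x y Lx Ly|i /andP[]//].
by move/forall_inP: (LU x Lx) => /(_ y Ly).
Qed.

Lemma joinL_lub (L : {set B8}) (P : B8 -> Prop) (z : B8) : 
  joinL L P \subset z <-> (forall y : B8, y \in L -> P y -> y \subset z).
Proof.
split=> [/bigcupsP h y Ly Py|h]; first by apply: h; rewrite Ly; apply/asboolP.
by apply/bigcupsP=> y /andP[Ly /asboolP]; apply: h.
Qed.

Lemma meetL_in L P : subalgebra L -> meetL L P \in L.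
Proof.
case/and5P=> _ L1 _ _ /forall_inP LI; rewrite /meetL.
elim/big_ind: _ => // [x y Lx Ly|i /andP[]//].
by move/forall_inP: (LI x Lx) => /(_ y Ly).
Qed.

Lemma meetL_glb (L : {set B8}) (P : B8 -> Prop) (z : B8) :
  z \subset meetL L P <-> (forall y : B8, y \in L -> P y -> z \subset y).
Proof.
split=> [/bigcapsP h y Ly Py|h]; first by apply: h; rewrite Ly; apply/asboolP.
by apply/bigcapsP=> y /andP[Ly /asboolP]; apply: h.
Qed.

Lemma eval_in F (M : model84 F) phi w : eval M phi w \in alg w.
Proof.
have /andP[sL _] := alg_subalgebra4 w.
have /and5P[L0 L1 /forall_inP LC /forall_inP LU /forall_inP LI] := sL.
elim: phi => /= [p|a IH|a _|a _|a IHa b IHb|a IHa b IHb].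
- exact: val84_in.
- exact: LC.
- exact: meetL_in.
- by rewrite /circled; case: ifP.
- by move/forall_inP: (LI _ IHa) => /(_ _ IHb).
- by move/forall_inP: (LU _ IHa) => /(_ _ IHb).
Qed.

(* Main.v *)
Require Import Defs.
From mathcomp Require Import all_boot.
From mathcomp Require Import boolp.

(** The implication from Euclidean to the validity of the schema fails, because
    a world sees the values of its successors only through its own algebra.  An
    ultrafilter of [B8] is the set of all elements above some atom [i]
    ([ultrafilter_principal]); let [j]
    be another atom and [k] the third.  Take two worlds [w] and [u], with [u] the
    only successor of both; this frame is Euclidean.  Let [u] carry the
    subalgebra generated by [i], and [w] the one generated by [j], which cannot
    tell [i] from [k].  If [p] has the value [{i}] at [u], then so has
    [Diamond p], since approximation is the identity on elements of the local
    algebra.  Seen from [w], [{i}] is [{i, k}] from above but [0] from below,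
    hence [Diamond p] is designated at [w] and [Box (Diamond p)] is not
    ([approx_atom_alg_set1], [lasso_refutes]). *)

Set Implicit Arguments.
Unset Strict Implicit.
Unset Printing Implicit Defensive.

(** * Ultrafilters and four-element subalgebras *)

(** Every proper filter [U] lies in a principal one: as [B8] is finite, the meet
    of all elements of [U] is in [U], hence is nonzero and contains an atom.
    Maximality turns the inclusion into an equality. *)
Lemma ultrafilter_principal (U : {set B8}) :
  ultrafilter U -> exists i : 'I_3, U = [set x : B8 | i \in x].
Proof.
case/maxsetP=> /and4P[UT U0 /forall_inP UI _] Umax.
have Um : \bigcap_(x in U) x \in U.
  elim/big_ind: _ => // x y Ux Uy.
  by move/forall_inP: (UI x Ux) => /(_ y Uy).
have /set0Pn[i mi] : \bigcap_(x in U) x != set0.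
  by apply: contraNneq U0 => <-.
exists i; apply/esym/Umax; last first.
  by apply/subsetP=> x Ux; rewrite inE; exact: (bigcapP mi).
apply/and4P; split; rewrite ?inE //.
- apply/forall_inP=> x; rewrite inE => xi; apply/forall_inP=> y.
  by rewrite !inE xi.
- apply/forall_inP=> x; rewrite inE => xi; apply/forallP=> y.
  by apply/implyP=> /subsetP xy; rewrite inE xy.
Qed.

(** The elements of the subalgebra generated by the atom [k] are determined by
    two independent bits: whether they contain [k], and whether they contain
    the other two atoms.  The Boolean operations act bitwise. *)
Definition two_valued (k : 'I_3) (bc : bool * bool) : B8 :=
  [set y | if y == k then bc.1 else bc.2].

Definition atom_alg (k : 'I_3) : {set B8} :=
  [set two_valued k bc | bc in [set: bool * bool]].

Lemma two_valued_in k bc : two_valued k bc \in atom_alg k.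
Proof. by apply: imset_f; rewrite inE. Qed.

Lemma two_valued_inj k : injective (two_valued k).
Proof.
move=> [b c] [b' c'] /setP e.
have := e k; rewrite !inE eqxx /= => ->.
have nk : ordS k != k by case: k {e} => [[|[|[|]]]].
by have := e (ordS k); rewrite !inE (negPf nk) /= => ->.
Qed.

Lemma atom_alg_subalgebra4 k : subalgebra4 (atom_alg k).
Proof.
apply/andP; split; last first.
  by rewrite card_imset ?cardsT ?card_prod ?card_bool //; exact: two_valued_inj.
apply/and5P; split.
- have -> : set0 = two_valued k (false, false).
    by apply/setP=> y; rewrite !inE if_same.
  exact: two_valued_in.
- have -> : setT = two_valued k (true, true).
    by apply/setP=> y; rewrite !inE if_same.
  exact: two_valued_in.
- apply/forall_inP=> _ /imsetP[[b c] _ ->].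
  have -> : ~: two_valued k (b, c) = two_valued k (~~ b, ~~ c).
    by apply/setP=> y; rewrite !inE; case: ifP.
  exact: two_valued_in.
- apply/forall_inP=> _ /imsetP[[b c] _ ->].
  apply/forall_inP=> _ /imsetP[[b' c'] _ ->].
  have -> : two_valued k (b, c) :|: two_valued k (b', c')
            = two_valued k (b || b', c || c').
    by apply/setP=> y; rewrite !inE; case: ifP.
  exact: two_valued_in.
- apply/forall_inP=> _ /imsetP[[b c] _ ->].
  apply/forall_inP=> _ /imsetP[[b' c'] _ ->].
  have -> : two_valued k (b, c) :&: two_valued k (b', c')
            = two_valued k (b && b', c && c').
    by apply/setP=> y; rewrite !inE; case: ifP.
  exact: two_valued_in.
Qed.

Lemma set0_in_atom_alg k : set0 \in atom_alg k.
Proof. by have /andP[/and5P[]] := atom_alg_subalgebra4 k. Qed.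

Lemma set1_in_atom_alg k : [set k] \in atom_alg k.
Proof.
have -> : [set k] = two_valued k (true, false).
  by apply/setP=> y; rewrite !inE; case: ifP.
exact: two_valued_in.
Qed.

Lemma atom_alg_indiscernible (i j k : 'I_3) (x : B8) :
  i != j -> k != j -> x \in atom_alg j -> (i \in x) = (k \in x).
Proof.
by move=> /negPf ij /negPf kj /imsetP[bc _ ->]; rewrite !inE ij kj.
Qed.

(** * Approximation and worlds with one successor *)

Lemma approx_sub (L : {set B8}) (x : B8) : approx L x \subset x.
Proof. by apply/joinL_lub. Qed.

Lemma approx_id (L : {set B8}) (x : B8) : x \in L -> approx L x = x.
Proof.
move=> Lx; apply/eqP; rewrite eqEsubset approx_sub /=.
by have /joinL_lub := subxx (approx L x); apply.
Qed.

(** An element of [atom_alg j] that contains [i] contains [k] as well, so it is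
    not below [{i}]. *)
Lemma approx_atom_alg_set1 (i j k : 'I_3) :
  i != j -> k != j -> k != i -> i \notin approx (atom_alg j) [set i].
Proof.
move=> ij kj ki.
have /andP[sL _] := atom_alg_subalgebra4 j.
rewrite (atom_alg_indiscernible ij kj (joinL_in _ sL)).
apply: contra ki => /(subsetP (approx_sub _ _)).
by rewrite inE.
Qed.

(** The meet has a single term, which is itself in the algebra of [w]. *)
Lemma eval_box_unique F (M : model84 F) a (w u : world F) :
  (forall u', acc w u' <-> u' = u) ->
  eval M (FBox a) w = approx (alg w) (eval M a u).
Proof.
move=> accE; have /andP[sL _] := alg_subalgebra4 w.
apply/eqP; rewrite eqEsubset /=; apply/andP; split.
- have /meetL_glb := subxx (eval M (FBox a) w); apply; first exact: joinL_in.
  by exists u; split=> //; apply/accE.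
- by apply/meetL_glb=> _ _ [u' [/accE-> ->]].
Qed.

(** * The counterexample *)

(** [true] is the root [w] and [false] the reflexive world [u]. *)
Definition lasso (i j : 'I_3) : frame84 :=
  @Frame84 bool (inhabits true) (fun _ u => u = false)
    (fun w => atom_alg (if w then j else i))
    (fun w => atom_alg_subalgebra4 (if w then j else i)).

Lemma lasso_euclidean i j : euclidean (lasso i j).
Proof. by []. Qed.

Definition lasso_val (i : 'I_3) (w : bool) (p : Var) : B8 :=
  if w then set0 else [set i].

Lemma lasso_val_in i j (w : world (lasso i j)) p : lasso_val i w p \in alg w.
Proof. by case: w; [exact: set0_in_atom_alg | exact: set1_in_atom_alg]. Qed.

Definition lasso_model i j : model84 (lasso i j) := Model84 (@lasso_val_in i j).

Lemma lasso_box i j a (w : world (lasso i j)) :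
  eval (lasso_model i j) (FBox a) w
  = approx (alg w) (eval (lasso_model i j) a false).
Proof. exact: eval_box_unique. Qed.

Lemma lasso_dia_false i j p :
  eval (lasso_model i j) (FDia (FVar p)) false = [set i].
Proof.
rewrite -[LHS]/(~: eval (lasso_model i j) (FBox (FNeg (FVar p))) false).
by rewrite lasso_box approx_id ?eval_in //= setCK.
Qed.

(** The first disjunct is the lower approximation of [~: [set i]], which omits
    [i]; the second is the lower approximation of [[set i]] in an algebra that
    does not separate [i] from [k]. *)
Lemma lasso_refutes (i j k : 'I_3) p : i != j -> k != j -> k != i ->
  i \notin eval (lasso_model i j)
             (FImp (FDia (FVar p)) (FBox (FDia (FVar p)))) true.
Proof.
move=> ij kj ki; set M := lasso_model i j.
rewrite -[eval _ _ _]/(~: ~: eval M (FBox (FNeg (FVar p))) true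
                       :|: eval M (FBox (FDia (FVar p))) true).
rewrite setCK inE negb_or !lasso_box lasso_dia_false (approx_atom_alg_set1 ij kj ki).
rewrite andbT; apply/negP => /(subsetP (approx_sub _ _)).
by rewrite !inE eqxx.
Qed.

Theorem theorem5p4 (U : {set B8}) (hU : ultrafilter U) :
  ~ (forall F : frame84,
       euclidean F <->
       (forall phi : formula, frame_valid U F (FImp (FDia phi) (FBox (FDia phi))))).
Proof.
have [i UE] := ultrafilter_principal hU => equiv.
have [j [k [ij kj ki]]] : exists j k : 'I_3, [/\ i != j, k != j & k != i].
  by exists (ordS i), (ordS (ordS i)); case: i {UE} => [[|[|[|]]]].
have := (equiv (lasso i j)).1 (@lasso_euclidean i j) (FVar 0) (lasso_model i j) true.
by rewrite /sat inE UE inE (negPf (lasso_refutes 0 ij kj ki)).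
Qed.
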